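(* Let $a,b$ be positive integers and let $\{F_n(q)\}_{n\geq 0}$ be the $q$-biperiodic Fibonacci sequence. For every $n\geq 0$, $F_{n+1}(q)$ counts the tilings weighted by bicolored squares of an $n$-board; that is, $$F_{n+1}(q)=\sum_{T\in\mathcal{T}_n}a^{|T|_a}b^{|T|_b}q^{|T|}.$$
   Context: Fix positive integers $a,b$; $q$ is an indeterminate. The $q$-biperiodic Fibonacci sequence is defined by $F_0(q)=0$, $F_1(q)=1$ and, for $n\geq 2$, $F_n(q)=aF_{n-1}(q)+q^{n-2}F_{n-2}(q)$ if $n$ is even, $F_n(q)=bF_{n-1}(q)+q^{n-2}F_{n-2}(q)$ if $n$ is odd. An $n$-board is a row of $n$ cells labelled $1,\dots,n$ from left to right; $\mathcal{T}_n$ is the set of all tilings of the $n$-board by squares (covering one cell) and dominoes (covering two consecutive cells $i,i+1$), with $\mathcal T_0$ consisting of the empty tiling. In a tiling weighted by bicolored squares, a square at an odd position can be given any of $a$ colors, a square at an even position any of $b$ colors, and a domino covering cells $i,i+1$ has weight $q^i$. For $T\in\mathcal{T}_n$ (with squares uncolored), $|T|_a$ is the number of squares of $T$ at odd positions, $|T|_b$ is the number of squares of $T$ at even positions, and $|T|$ is the sum of all $i$ such that $T$ has a domino in position $(i,i+1)$. *)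

(* Defs.v *)
From mathcomp Require Import all_boot all_order all_algebra.

Set Implicit Arguments.
Unset Strict Implicit.
Unset Printing Implicit Defensive.

Import GRing.Theory.
Local Open Scope ring_scope.

(** The q-biperiodic Fibonacci sequence, as polynomials in the indeterminate
    [q = 'X]. *)
Fixpoint qFib (a b n : nat) {struct n} : {poly int} :=
  match n with
  | 0 => 0
  | 1 => 1
  | (k.+1 as m).+1 =>
      (if odd k.+2 then b else a)%:R * qFib a b m + 'X^k * qFib a b k
  end.

(** The cell with label [l] (1 <= l <= n) of the n-board is the ordinal of value
    [l - 1]; labels, not ordinal values, determine parities and weights. *)
Definition label (n : nat) (i : 'I_n) : nat := i.+1.

Definition is_square (n : nat) (B : {set 'I_n}) : bool :=
  [exists i, B == [set i]].

Definition is_domino (n : nat) (B : {set 'I_n}) : bool :=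
  [exists i, exists j, (label j == (label i).+1) && (B == [set i; j])].

Definition tilings (n : nat) : {set {set {set 'I_n}}} :=
  [set T : {set {set 'I_n}} | partition T [set: 'I_n]
                            & [forall B in T, is_square B || is_domino B]].

Definition square_at (n : nat) (T : {set {set 'I_n}}) (i : 'I_n) : bool :=
  [set i] \in T.

Definition domino_at (n : nat) (T : {set {set 'I_n}}) (i : 'I_n) : bool :=
  [exists j, (label j == (label i).+1) && ([set i; j] \in T)].

(** [|T|_a], [|T|_b] and [|T|]. *)
Definition odd_squares (n : nat) (T : {set {set 'I_n}}) : nat :=
  #|[set i | square_at T i & odd (label i)]|.

Definition even_squares (n : nat) (T : {set {set 'I_n}}) : nat :=
  #|[set i | square_at T i & ~~ odd (label i)]|.

Definition domino_weight (n : nat) (T : {set {set 'I_n}}) : nat :=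
  (\sum_(i | domino_at T i) label i)%N.

(** A colouring of [T] is encoded as a function on all cells, with value [None]
    exactly on the cells covered by dominoes; it takes one of the [a] colours
    [inl _] on squares at odd positions and one of the [b] colours [inr _] on
    squares at even positions. *)
Definition proper_colour (a b n : nat) (T : {set {set 'I_n}}) (i : 'I_n)
    (c : option ('I_a + 'I_b)) : bool :=
  match c with
  | None => ~~ square_at T i
  | Some (inl _) => square_at T i && odd (label i)
  | Some (inr _) => square_at T i && ~~ odd (label i)
  end.

Definition coloured_tilings (a b n : nat) :
    {set {set {set 'I_n}} * {ffun 'I_n -> option ('I_a + 'I_b)}} :=
  [set S : {set {set 'I_n}} * {ffun 'I_n -> option ('I_a + 'I_b)}
     | S.1 \in tilings n & [forall i, proper_colour S.1 i (S.2 i)]].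

(* Main.v *)
Require Import Defs.
From mathcomp Require Import all_boot all_order all_algebra.
From mathcomp Require Import zify.

Import GRing.Theory.
Local Open Scope ring_scope.

(** Removing from a partition the block that contains a chosen point gives a
    recursion for the generating function of the partitions of a set into weighted
    blocks. On the first [k + 2] cells, the block of the last cell is a square or
    a domino, and the recursion is that of the q-biperiodic Fibonacci sequence.
    The weight of a square is its number of colours, so that the weight of a tiling
    is the number of its proper colourings times its power of [q]. *)

Definition partition_sum {R : comNzRingType} {U : finType}
    (P : pred {set U}) (w : {set U} -> R) (D : {set U}) : R :=
  \sum_(T : {set {set U}} | partition T D && [forall B in T, P B])
     \prod_(B in T) w B.

Lemma partition_sum0 (R : comNzRingType) (U : finType)
    (P : pred {set U}) (w : {set U} -> R) : partition_sum P w set0 = 1.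
Proof.
rewrite /partition_sum (big_pred1 set0) ?big_set0 // => T /=.
rewrite partition_set0; case: eqP => //= ->.
by apply/forall_inP => B; rewrite inE.
Qed.

(** Group the partitions [T] of [D] by the block [B] containing [x]. For fixed [B], deleting [B] is
    a bijection onto the partitions of [D :\: B], inverse to adding [B], and it takes the factor
    [w B] out of the product. *)
Lemma partition_sum_rec (R : comNzRingType) (U : finType)
    (P : pred {set U}) (w : {set U} -> R) (D : {set U}) (x : U) : x \in D ->
  partition_sum P w D =
    \sum_(B : {set U} | [&& x \in B, B \subset D & P B])
       w B * partition_sum P w (D :\: B).
Proof.
move=> xD; rewrite /partition_sum.
rewrite (partition_big (fun T => pblock T x)
  (fun B : {set U} => [&& x \in B, B \subset D & P B])) /=; last first.
  move=> T /andP[pT /forall_inP TP]; have xT : x \in cover T.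
    by rewrite (cover_partition pT).
  by rewrite mem_pblock xT (partitionS pT (pblock_mem xT)) TP ?pblock_mem.
apply: eq_bigr => B /and3P[xB BD PB]; rewrite big_distrr /=.
rewrite (reindex_onto (fun T => B |: T) (fun T => T :\ B)) /=; last first.
  move=> T /andP[/andP[pT _] /eqP <-].
  by rewrite setD1K // pblock_mem // (cover_partition pT).
(* As [x] lies in [B] but not in [D :\: B], adding [B] always creates a new block, and removing it
   again gives back [T]. *)
have nBT T : partition T (D :\: B) -> B \notin T.
  move=> pT; apply/negP => /(partitionS pT)/subsetP/(_ x xB).
  by rewrite inE xB.
apply: eq_big => T; last first.
  move=> /andP[_ /eqP eT]; rewrite big_setU1 // -eT.
  by rewrite !inE eqxx.
apply/idP/idP.
  case/andP=> /andP[/andP[pT /forall_inP TP] _] /eqP eT.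
  rewrite -{1}eT (partitionD1 pT) ?setU11 //=.
  by apply/forall_inP => C CT; apply: TP; rewrite inE CT orbT.
case/andP=> pT /forall_inP TP.
have pBT : partition (B |: T) D.
  rewrite (_ : D = B :|: (D :\: B)); last by rewrite -{1}(setID D B) (setIidPr BD).
  apply: partitionU1 => //; first by apply/set0Pn; exists x.
  by rewrite -setI_eq0 setIDA setIC setDIl setDv setI0.
rewrite pBT (def_pblock (partition_trivIset pBT) (setU11 _ _) xB) eqxx andbT.
rewrite setU1K ?nBT // eqxx andbT.
by apply/forall_inP => C /setU1P[->|/TP].
Qed.

(** * Weights of squares and dominoes *)

Definition domino_start {n : nat} (B : {set 'I_n}) (i : 'I_n) : bool :=
  [exists j, (label j == (label i).+1) && (B == [set i; j])].

Definition square_weight (a b : nat) {n : nat} (i : 'I_n) : {poly int} :=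
  (if odd (label i) then a else b)%:R.

(** Each product has at most one factor and is 1 if [B] has the other shape. This replaces a choice
    of the cell from [B], and allows products over blocks and over cells to be exchanged later. *)
Definition block_weight (a b : nat) {n : nat} (B : {set 'I_n}) : {poly int} :=
  (\prod_(i | B == [set i]) square_weight a b i) *
  (\prod_(i | domino_start B i) 'X^(label i)).

Lemma set2_eq_set1 (U : finType) (x y z : U) : y != z -> ([set y; z] == [set x]) = false.
Proof.
move=> yz; apply/eqP => e; have := set21 y z; have := set22 y z.
by rewrite e !inE => /eqP <- /eqP e'; rewrite e' eqxx in yz.
Qed.

Lemma domino_start_set1 (n : nat) (x i : 'I_n) : domino_start [set x] i = false.
Proof.
apply/existsP => -[j /andP[/eqP lij]]; rewrite eq_sym set2_eq_set1 //.
by apply: contra_eq_neq lij => ->; rewrite neq_ltn ltnSn.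
Qed.

Lemma domino_start_set2 (n : nat) (x y i : 'I_n) : label y = (label x).+1 ->
  domino_start [set x; y] i = (i == x).
Proof.
rewrite /label => lxy; apply/existsP/eqP => [[j /andP[/eqP lij /eqP e]]|->]; last first.
  by exists y; rewrite /label lxy !eqxx.
apply: val_inj => /=; move: lij; rewrite /label.
have := set22 i j; have := set21 i j.
by rewrite -{1 2}e !inE -!val_eqE /= => /orP[] /eqP ? /orP[] /eqP ?; lia.
Qed.

Lemma block_weight_square (a b n : nat) (x : 'I_n) :
  block_weight a b [set x] = square_weight a b x.
Proof.
rewrite /block_weight (big_pred1 x) => [|i]; last first.
  by rewrite (inj_eq set1_inj) eq_sym.
by rewrite big_pred0 ?mulr1 // => i; rewrite domino_start_set1.
Qed.

Lemma block_weight_domino (a b n : nat) (x y : 'I_n) : label y = (label x).+1 ->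
  block_weight a b [set x; y] = 'X^(label x).
Proof.
move=> lxy; have xy : x != y by apply: contra_eq_neq lxy => ->; rewrite neq_ltn ltnSn.
rewrite /block_weight big_pred0 => [|i]; last by rewrite set2_eq_set1.
by rewrite mul1r (big_pred1 x) // => i; rewrite domino_start_set2.
Qed.

(** * The recursion on the first cells of the board *)

Definition initial_cells (n k : nat) : {set 'I_n} := [set i : 'I_n | (i < k)%N].

Definition tile {n : nat} (B : {set 'I_n}) : bool := is_square B || is_domino B.

Lemma tileP (n : nat) (B : {set 'I_n}) (x : 'I_n) :
  x \in B -> B \subset initial_cells n x.+1 ->
  tile B -> B = [set x] \/ exists2 y : 'I_n, label x = (label y).+1 & B = [set y; x].
Proof.
move=> xB /subsetP sB /orP[/existsP[i /eqP eB]|].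
  by left; move: xB; rewrite eB inE => /eqP ->.
move=> /existsP[i /existsP[j /andP[/eqP lij /eqP eB]]]; right.
(* No cell of [B] lies to the right of [x], so [x] must be the right half of the domino. *)
suff xj : x = j by exists i; rewrite ?xj.
have: j \in B by rewrite eB set22.
move/sB; rewrite inE => jx; apply: val_inj => /=.
by move: xB lij jx; rewrite eB !inE -!val_eqE /label /= => /orP[] /eqP; lia.
Qed.

Lemma tile_set1 (n : nat) (x : 'I_n) : tile [set x].
Proof. by apply/orP; left; apply/existsP; exists x. Qed.

Lemma tile_set2 (n : nat) (x y : 'I_n) : label y = (label x).+1 -> tile [set x; y].
Proof.
move=> lxy; apply/orP; right; apply/existsP; exists x; apply/existsP; exists y.
by rewrite lxy !eqxx.
Qed.

(** Only [k] varies in the recursion: the shorter boards are subsets of the same ['I_n], so no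
    tiling has to be moved to another type. *)
Definition board_sum (a b n k : nat) : {poly int} :=
  partition_sum tile (block_weight a b) (initial_cells n k).

Lemma board_sum0 (a b n : nat) : board_sum a b n 0 = 1.
Proof.
by rewrite /board_sum (_ : initial_cells n 0 = set0) ?partition_sum0 //.
Qed.

Lemma board_sum1 (a b n : nat) : (0 < n)%N -> board_sum a b n 1 = a%:R.
Proof.
move=> n_gt0; pose x : 'I_n := Ordinal n_gt0.
rewrite /board_sum (@partition_sum_rec _ _ _ _ _ x) ?inE //.
have -> : initial_cells n 1 = [set x].
  by apply/setP => i; rewrite !inE ltnS leqn0.
rewrite (big_pred1 [set x]) => [|B /=].
  by rewrite setDv partition_sum0 mulr1 block_weight_square.
apply/and3P/eqP => [[xB sB _]|->]; last by rewrite set11 subxx tile_set1.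
by apply/eqP; rewrite eqEsubset sB sub1set.
Qed.

Lemma board_sum_rec (a b n k : nat) : (k.+2 <= n)%N ->
  board_sum a b n k.+2 =
    (if odd k.+3 then b else a)%:R * board_sum a b n k.+1 + 'X^(k.+1) * board_sum a b n k.
Proof.
(* The last cell [x] has label [k.+2] and its left neighbour [y] has label [k.+1], the exponent of a
   domino covering both. *)
move=> lt_kn; pose x : 'I_n := Ordinal lt_kn; pose y : 'I_n := Ordinal (ltnW lt_kn).
have lyx : label x = (label y).+1 by [].
rewrite /board_sum (@partition_sum_rec _ _ _ _ _ x) ?inE //.
rewrite (bigD1 [set x]) /=; last first.
  by rewrite set11 tile_set1 sub1set inE /= ltnSn.
rewrite (big_pred1 [set y; x]) => [|B /=].
  rewrite block_weight_square (block_weight_domino _ _ _ _ _ lyx); congr (_ * _ + _ * _).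
  (* The Fibonacci index [k.+3] exceeds the label of [x] by one, so the parities are opposite: [b]
     goes with an odd index and an even position. *)
  - by rewrite /square_weight /label /= negbK; case: odd.
  - congr partition_sum; apply/setP => i.
    by rewrite !inE -val_eqE /=; lia.
  - congr partition_sum; apply/setP => i.
    by rewrite !inE -!val_eqE /=; lia.
apply/andP/eqP => [[/and3P[xB sB tB] Bx]|->].
  have [eB|[z lzx eB]] := tileP _ _ _ xB sB tB; first by rewrite eB eqxx in Bx.
  rewrite eB; congr [set _; _]; apply: val_inj.
  by move: lzx; rewrite /label /= => -[].
have yx : y != x by rewrite -val_eqE /= neq_ltn ltnSn.
rewrite set22 (tile_set2 _ _ _ lyx) set2_eq_set1 // andbT; split=> //.
by rewrite /= subUset !sub1set !inE /=; lia.
Qed.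

Lemma board_sum_qFib (a b n k : nat) : (k <= n)%N -> board_sum a b n k = qFib a b k.+1.
Proof.
elim/ltn_ind: k => -[|[|k]] IH le_kn; first by rewrite board_sum0.
  by rewrite board_sum1 //= mulr1 mulr0 addr0.
by rewrite board_sum_rec // !IH ?(ltnW le_kn) // ltnW // ltnW.
Qed.

(** * From block weights to the statistics of a tiling *)

Lemma domino_atE (n : nat) (T : {set {set 'I_n}}) (i : 'I_n) :
  domino_at T i = [exists B in T, domino_start B i].
Proof.
apply/existsP/exists_inP => [[j /andP[lij ijT]]|[B BT /existsP[j /andP[lij /eqP eB]]]].
  by exists [set i; j] => //; apply/existsP; exists j; rewrite lij eqxx.
by exists j; rewrite lij -eB.
Qed.

Lemma domino_start_inj (n : nat) (A B : {set 'I_n}) (i : 'I_n) :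
  domino_start A i -> domino_start B i -> A = B.
Proof.
move=> /existsP[j /andP[/eqP lj /eqP ->]] /existsP[k /andP[/eqP lk /eqP ->]].
by congr [set _; _]; apply: val_inj; move: lj; rewrite -lk => -[].
Qed.

(** Exchange the product over blocks with the product over cells: a cell [i] is the square [[set i]]
    of at most one block, and by [domino_start_inj] at most one domino starts at [i]. Splitting the
    square cells by parity separates the powers of [a] and [b]. *)
Lemma prod_block_weight (a b n : nat) (T : {set {set 'I_n}}) :
  \prod_(B in T) block_weight a b B =
    a%:R ^+ odd_squares T * b%:R ^+ even_squares T * 'X^(domino_weight T).
Proof.
rewrite big_split /=; congr (_ * _).
  rewrite (exchange_big_dep xpredT) //=.
  rewrite (eq_bigr (fun i => if square_at T i then square_weight a b i else 1)).
    rewrite -big_mkcond (bigID (fun i : 'I_n => odd (label i))) /=.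
    rewrite /odd_squares /even_squares -!prodr_const; congr (_ * _).
      by apply: eq_big => i; [rewrite inE|rewrite /square_weight /= => /andP[_]; case: odd].
    by apply: eq_big => i; [rewrite inE|rewrite /square_weight /= => /andP[_]; case: odd].
  move=> i _; case: ifP => iT.
    by rewrite (big_pred1 [set i]) // => B; apply/andP/eqP => [[_ /eqP]|->].
  by rewrite big_pred0 // => B; apply/andP => -[BT /eqP eB]; rewrite /square_at -eB BT in iT.
rewrite (exchange_big_dep xpredT) //= /domino_weight -prodrXr big_mkcond /=.
rewrite [RHS]big_mkcond /=; apply: eq_bigr => i _; rewrite domino_atE.
case: exists_inP => [[A AT Ai]|nT].
  rewrite (big_pred1 A) // => B; apply/andP/eqP => [[_ Bi]|-> //].
  exact: domino_start_inj Bi Ai.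
by rewrite big_pred0 // => B; apply/andP => -[BT Bi]; apply: nT; exists B.
Qed.

Lemma card_proper_colours (a b n : nat) (T : {set {set 'I_n}}) (i : 'I_n) :
  #|@proper_colour a b n T i| =
    if square_at T i then if odd (label i) then a else b else 1%N.
Proof.
case: ifP => iT; last first.
  by rewrite (@eq_card1 _ None) // => -[[c|c]|]; rewrite !inE /in_mem /= iT.
rewrite /label /=; case: ifP => odd_i.
  (* On an odd square the admissible values are the image of ['I_a] under the injection
     [Some \o inl]; even squares use [Some \o inr] on ['I_b]. *)
  rewrite -[RHS]card_ord -(card_codom (f := Some \o inl : 'I_a -> option ('I_a + 'I_b))).
    apply: eq_card => -[[c|c]|]; rewrite [LHS]/in_mem /= ?iT ?odd_i /=.
    - by apply/esym/codomP; exists c.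
    - by apply/esym/codomP => -[].
    - by apply/esym/codomP => -[].
  by move=> c d [].
rewrite -[RHS]card_ord -(card_codom (f := Some \o inr : 'I_b -> option ('I_a + 'I_b))).
  apply: eq_card => -[[c|c]|]; rewrite [LHS]/in_mem /= ?iT ?odd_i /=.
  - by apply/esym/codomP => -[].
  - by apply/esym/codomP; exists c.
  - by apply/esym/codomP => -[].
by move=> c d [].
Qed.

Lemma prod_card_proper_colours (a b n : nat) (T : {set {set 'I_n}}) :
  (\prod_i #|@proper_colour a b n T i| = a ^ odd_squares T * b ^ even_squares T)%N.
Proof.
rewrite (eq_bigr _ (fun i _ => card_proper_colours a b n T i)) -big_mkcond /=.
rewrite (bigID (fun i : 'I_n => odd (label i))) /=.
rewrite /odd_squares /even_squares -!prod_nat_const; congr (_ * _)%N.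
  by apply: eq_big => i; [rewrite inE|move=> /= /andP[_]; case: odd].
by apply: eq_big => i; [rewrite inE|move=> /= /andP[_]; case: odd].
Qed.

Theorem theorem11 (a b : nat) (a_gt0 : (0 < a)%N) (b_gt0 : (0 < b)%N) (n : nat) :
  qFib a b n.+1 = \sum_(S in coloured_tilings a b n) 'X^(domino_weight S.1)
  /\ qFib a b n.+1 =
     \sum_(T in tilings n)
       a%:R ^+ odd_squares T * b%:R ^+ even_squares T * 'X^(domino_weight T).
Proof.
have tilingsE : qFib a b n.+1 = \sum_(T in tilings n) \prod_(B in T) block_weight a b B.
  rewrite -(board_sum_qFib a b n n (leqnn n)); apply: eq_bigl => T.
  rewrite inE; congr (partition _ _ && _).
  by apply/setP => i; rewrite !inE ltn_ord.
split; last by rewrite tilingsE; apply: eq_bigr => T _; rewrite prod_block_weight.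
(* Coloured tilings are grouped by their underlying tiling. *)
rewrite tilingsE [RHS](partition_big fst (mem (tilings n))) /=; last first.
  by move=> S; rewrite inE => /andP[].
apply: eq_bigr => T Tn; rewrite prod_block_weight.
(* The proper colourings of [T] form a family with independent choices at each cell, so their number
   is the product of the numbers of choices. *)
transitivity (\sum_(f in family (@proper_colour a b n T)) 'X^(domino_weight T) : {poly int}).
  rewrite sumr_const card_family foldrE big_image /= prod_card_proper_colours.
  by rewrite -[RHS]mulr_natl natrM !natrX.
rewrite (reindex_onto (fun f => (T, f)) snd) /=; last by case=> T' f /= /andP[_ /eqP ->].
apply: eq_bigl => f; rewrite in_set /= Tn !eqxx !andbT.
by apply/familyP/forallP.
Qed.
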